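(* Let $k$ be an algebraically closed field of characteristic $p>0$, let $A$ be an integral $k$-algebra of finite type, and let $\mathcal{D}$ be any collection of $k$-derivations on $A$. Then the $\mathbb{F}_p$-vector space $\Pi(A,\mathcal{D})$ is finite dimensional.
   Context: ''Integral'' means that the (commutative) ring $A$ is an integral domain; $K(A)$ denotes its fraction field. $Der_k(A)$ is the set of $k$-derivations $A\to A$; each such derivation extends uniquely to $K(A)$ by the quotient rule. For a collection $\mathcal{D}\subseteq Der_k(A)$: an element $f\in K(A)^*$ is an algebraic solution of $\mathcal{D}$ if $D(f)/f\in A$ for every $D\in\mathcal{D}$; an element $f\in K(A)^*$ is a (rational) first integral of $\mathcal{D}$ if $D(f)=0$ for every $D\in\mathcal{D}$. Both sets are subgroups of the multiplicative group $K(A)^*$, and first integrals are algebraic solutions. Define the quotient group $\Pi(A,\mathcal{D})=\{\text{algebraic solutions of }\mathcal{D}\}/\{\text{first integrals of }\mathcal{D}\}$. Since $D(f^p)=0$ for all $f\in K(A)$ and all $D\in Der_k(A)$, this abelian group is killed by $p$, hence is a vector space over $\mathbb{F}_p=\mathbb{Z}/p$. *)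

(* Defs.v *)
From HB Require Import structures.
From mathcomp Require Import all_boot all_algebra.
From mathcomp Require Import boolp classical_sets.
From mathcomp Require Import mpoly ring.

Set Implicit Arguments.
Unset Strict Implicit.
Unset Printing Implicit Defensive.

Import GRing.Theory.

Local Open Scope ring_scope.
Local Open Scope quotient_scope.

#[short(type="idomainAlgType")]
HB.structure Definition IdomainAlgebra (k : nzRingType) :=
  {A of GRing.ComUnitAlgebra k A & GRing.IntegralDomain A}.

Notation "x %:F" := (@FracField.tofrac _ x) : ring_scope.

Definition finite_type (k : comNzRingType) (A : comAlgType k) : Prop :=
  exists (n : nat) (x : 'I_n -> A),
    forall a : A, exists q : {mpoly k[n]}, a = mmap (in_alg A) x q.

(* Identities in an abstract field: computing directly in {fraction A} is slow. *)
Section QuotientRule.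
Variables (F : fieldType).
Implicit Types (a b c d u v w z : F).

Let quotient_rule a u b v := (u * b - a * v) / b ^+ 2.

Lemma quotient_rule_eq a u b v c w d z : b != 0 -> d != 0 ->
    a / b = c / d -> u * d + a * z = w * b + c * v ->
  quotient_rule c w d z = quotient_rule a u b v.
Proof.
move=> b0 d0 abcd Dadcb; rewrite /quotient_rule.
have c_ : c = a * d / b by rewrite mulrAC abcd mulfVK.
have w_ : w = (u * d + a * z - c * v) / b by rewrite Dadcb addrK mulfK.
by rewrite w_ c_; field; apply/andP.
Qed.

Lemma quotient_ruleD a u b v c w d z : b != 0 -> d != 0 ->
  quotient_rule (a * d + c * b) (u * d + a * z + (w * b + c * v))
    (b * d) (v * d + b * z) = quotient_rule a u b v + quotient_rule c w d z.
Proof. by move=> b0 d0; rewrite /quotient_rule; field; apply/andP. Qed.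

Lemma quotient_ruleM a u b v c w d z : b != 0 -> d != 0 ->
  quotient_rule (a * c) (u * c + a * w) (b * d) (v * d + b * z) =
  quotient_rule a u b v * (c / d) + a / b * quotient_rule c w d z.
Proof. by move=> b0 d0; rewrite /quotient_rule; field; apply/andP. Qed.

Lemma quotient_rule_uniq a u b v e : b != 0 ->
  u = e * b + a / b * v -> e = quotient_rule a u b v.
Proof. by move=> b0 ->; rewrite /quotient_rule; field. Qed.

Lemma quotient_rule1 a u : (u * 1 - a * 0) / 1 ^+ 2 = u.
Proof. by rewrite mulr1 mulr0 subr0 expr1n divr1. Qed.

Lemma inverse_rule f u w : f != 0 ->
  0 = u * f^-1 + f * w -> w = - u / f ^+ 2.
Proof.
move=> f0 /eqP; rewrite eq_sym addrC addr_eq0 => /eqP h.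
by apply: (mulfI f0); rewrite h; field.
Qed.

Lemma logderM f g u v : f != 0 -> g != 0 ->
  (u * g + f * v) / (f * g) = u / f + v / g.
Proof. by move=> f0 g0; field; apply/andP. Qed.

Lemma logderV f u : f != 0 -> (- u / f ^+ 2) / f^-1 = - (u / f).
Proof. by move=> f0; rewrite invrK; field. Qed.

End QuotientRule.

Section Derivations.
Variables (k : fieldType) (A : idomainAlgType k).
Implicit Types (a b : A) (f g : {fraction A}).

Record derivation := Derivation {
  der_linear :> {linear A -> A};
  derM : forall a b, der_linear (a * b) = der_linear a * b + a * der_linear b
}.

Implicit Type D : derivation.

(* The extension of D to K(A) by the quotient rule; [derfracE] shows that it
   does not depend on the representative. *)
Definition derfrac D f : {fraction A} :=
  let x := repr f in
  ((D \n_x)%:F * (\d_x)%:F - (\n_x)%:F * (D \d_x)%:F) / (\d_x)%:F ^+ 2.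

Lemma fracE f : f = (\n_(repr f))%:F / (\d_(repr f))%:F.
Proof.
have d0 := denom_ratioP (repr f).
apply: (canRL (mulfK _)); first by rewrite tofrac_eq0.
rewrite -{1}[f]reprK; unlock FracField.tofrac.
apply: etrans (esym (FracField.pi_mul _ _)) _; apply/eqmodP.
rewrite /= FracField.equivfE /FracField.mulf.
by rewrite !numden_Ratio ?oner_eq0 ?mulr1 // mulrC.
Qed.

Lemma fracP f : exists a b, b%:F != 0 /\ f = a%:F / b%:F.
Proof.
exists \n_(repr f), \d_(repr f); split; last exact: fracE.
by rewrite tofrac_eq0 denom_ratioP.
Qed.

Lemma tofrac_derM D a b :
  (D (a * b))%:F = (D a)%:F * b%:F + a%:F * (D b)%:F :> {fraction A}.
Proof. by rewrite derM tofracD; congr (_ + _); apply: tofracM. Qed.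

Lemma derfracE D a b : b%:F != 0 :> {fraction A} ->
  derfrac D (a%:F / b%:F) = ((D a)%:F * b%:F - a%:F * (D b)%:F) / b%:F ^+ 2.
Proof.
move=> Fb0; rewrite /derfrac.
have := fracE (a%:F / b%:F); have := denom_ratioP (repr (a%:F / b%:F)).
move: (\n_ _) (\d_ _) => c d d0 E.
have Fd0 : d%:F != 0 by rewrite tofrac_eq0.
apply: (quotient_rule_eq Fb0 Fd0 E); rewrite -!tofrac_derM; congr (D _)%:F.
apply/eqP; rewrite -tofrac_eq; apply/eqP.
apply: etrans (tofracM _ _) _; apply: etrans (esym (tofracM _ _)).
by move/eqP: E; rewrite (eqr_div _ _ Fb0 Fd0) => /eqP.
Qed.

Lemma der1 D : D 1 = 0.
Proof.
by apply: (addrI (D 1)); have := derM D 1 1; rewrite !mulr1 mul1r addr0 => <-.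
Qed.

Lemma derfrac_tofrac D a : derfrac D a%:F = (D a)%:F.
Proof.
have F1 : 1%:F = 1 :> {fraction A} := tofrac1 A.
have := @derfracE D a 1; rewrite F1 der1 tofrac0 divr1 quotient_rule1.
by apply; exact: oner_neq0.
Qed.

Lemma derfracD D f g : derfrac D (f + g) = derfrac D f + derfrac D g.
Proof.
have [a [b [b0 ->]]] := fracP f; have [c [d [d0 ->]]] := fracP g.
rewrite (addf_div _ _ b0 d0) (derfracE D a b0) (derfracE D c d0).
rewrite -(quotient_ruleD _ _ _ _ _ _ b0 d0) -!tofrac_derM -!tofracD.
rewrite -(tofracM a d) -(tofracM c b) -(tofracM b d) -!tofracD -linearD.
apply: derfracE; rewrite (tofracM b d); exact: (mulf_neq0 b0 d0).
Qed.

Lemma derfracM D f g : derfrac D (f * g) = derfrac D f * g + f * derfrac D g.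
Proof.
have [a [b [b0 ->]]] := fracP f; have [c [d [d0 ->]]] := fracP g.
rewrite mulf_div (derfracE D a b0) (derfracE D c d0).
rewrite -(quotient_ruleM _ _ _ _ _ _ b0 d0) -!tofrac_derM.
rewrite -(tofracM a c) -(tofracM b d).
apply: derfracE; rewrite (tofracM b d); exact: (mulf_neq0 b0 d0).
Qed.

Lemma derfrac_uniq D (E : {fraction A} -> {fraction A}) :
    (forall a, E a%:F = (D a)%:F) ->
    (forall f g, E (f * g) = E f * g + f * E g) ->
  E =1 derfrac D.
Proof.
move=> EF EM f; have [a [b [b0 ->]]] := fracP f.
rewrite (derfracE D a b0); apply: (quotient_rule_uniq b0).
by rewrite -!EF -EM (mulfVK b0).
Qed.

Lemma derfrac1 D : derfrac D 1 = 0.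
Proof. by have := derfrac_tofrac D 1; rewrite tofrac1 der1 tofrac0. Qed.

Lemma derfracV D f : f != 0 -> derfrac D f^-1 = - derfrac D f / f ^+ 2.
Proof.
move=> f0; apply: (inverse_rule f0).
by rewrite -derfracM (divff f0) derfrac1.
Qed.

Lemma derfracX D f n : derfrac D (f ^+ n) = f ^+ n.-1 * derfrac D f *+ n.
Proof.
elim: n => [|[|n] IHn]; first by rewrite expr0 derfrac1 mulr0n.
  by rewrite expr1 expr0 mul1r.
rewrite exprS derfracM IHn /= mulrnAr mulrA -exprS [_ * f ^+ _]mulrC.
by rewrite -mulrS.
Qed.

End Derivations.

Section AlgebraicSolutions.
Variables (k : fieldType) (A : idomainAlgType k) (DD : set (derivation A)).
Implicit Types (f g : {fraction A}).

Definition algebraic_solution f : Prop :=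
  f != 0 /\
  forall D, DD D -> exists a : A, derfrac D f / f = a%:F.

Definition first_integral f : Prop :=
  f != 0 /\ forall D, DD D -> derfrac D f = 0.

Lemma first_integral_algebraic f : first_integral f -> algebraic_solution f.
Proof.
by move=> [f0 Df]; split=> // D /Df ->; exists 0; rewrite mul0r tofrac0.
Qed.

Lemma algebraic_solution1 : algebraic_solution 1.
Proof.
apply: first_integral_algebraic; split; first exact: oner_neq0.
by move=> D _; exact: derfrac1.
Qed.

Lemma algebraic_solutionM f g :
  algebraic_solution f -> algebraic_solution g -> algebraic_solution (f * g).
Proof.
move=> [f0 Df] [g0 Dg]; split=> [|D DD_D]; first exact: (mulf_neq0 f0 g0).
have [[a Ea] [b Eb]] := (Df D DD_D, Dg D DD_D).
by exists (a + b); rewrite tofracD -Ea -Eb derfracM; apply: (logderM _ _ f0 g0).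
Qed.

Lemma algebraic_solutionV f :
  algebraic_solution f -> algebraic_solution f^-1.
Proof.
move=> [f0 Df]; split=> [|D /Df[a Ea]]; first exact: invr_neq0.
by exists (- a); rewrite tofracN -Ea (derfracV D f0); apply: logderV.
Qed.

(* The group of algebraic solutions under multiplication, written additively:
   its zero is the constant 1 and f + g stands for the product f g. *)
Record algsol := AlgSol {
  algsol_val :> {fraction A};
  _ : `[< algebraic_solution algsol_val >]
}.

HB.instance Definition _ := [isSub for algsol_val].
HB.instance Definition _ := [Choice of algsol by <:].

Lemma algsolP (u : algsol) : algebraic_solution u.
Proof. by case: u => f /= /asboolP. Qed.

Lemma algsol_neq0 (u : algsol) : (u : {fraction A}) != 0.
Proof. by have [] := algsolP u. Qed.

Definition algsol_one := AlgSol (asboolT algebraic_solution1).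
Definition algsol_inv (u : algsol) :=
  AlgSol (asboolT (algebraic_solutionV (algsolP u))).
Definition algsol_mul (u v : algsol) :=
  AlgSol (asboolT (algebraic_solutionM (algsolP u) (algsolP v))).

Fact algsol_mulA : associative algsol_mul.
Proof. by move=> u v w; apply: val_inj; exact: mulrA. Qed.
Fact algsol_mulC : commutative algsol_mul.
Proof. by move=> u v; apply: val_inj; exact: mulrC. Qed.
Fact algsol_mul1 : left_id algsol_one algsol_mul.
Proof. by move=> u; apply: val_inj; exact: mul1r. Qed.
Fact algsol_mulV : left_inverse algsol_one algsol_inv algsol_mul.
Proof. by move=> u; apply: val_inj; apply: mulVf; exact: algsol_neq0. Qed.

HB.instance Definition _ :=
  GRing.isZmodule.Build algsol algsol_mulA algsol_mulC algsol_mul1 algsol_mulV.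

Lemma algsol_val0 : algsol_val 0 = 1. Proof. by []. Qed.
Lemma algsol_valN u : algsol_val (- u) = (algsol_val u)^-1.
Proof. by []. Qed.
Lemma algsol_valD u v : algsol_val (u + v) = algsol_val u * algsol_val v.
Proof. by []. Qed.
Lemma algsol_valMn u n : algsol_val (u *+ n) = algsol_val u ^+ n.
Proof. by elim: n => // n IHn; rewrite mulrS algsol_valD IHn exprS. Qed.

Definition firstint : {pred algsol} :=
  fun u => `[< first_integral (algsol_val u) >].

Fact firstint_zmod_closed : zmod_closed firstint.
Proof.
split=> [|u v /asboolP[u0 Du] /asboolP[v0 Dv]]; apply/asboolP.
  by split=> [|D _]; [exact: oner_neq0|exact: derfrac1].
split=> [|D DD_D]; first exact: algsol_neq0.
rewrite algsol_valD algsol_valN derfracM derfracV // Du // Dv //.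
by rewrite oppr0 !mul0r mulr0 addr0.
Qed.

HB.instance Definition _ :=
  GRing.isZmodClosed.Build algsol firstint firstint_zmod_closed.

Variables (p : nat) (pchar_k : p \in [pchar k]).

Lemma firstintMp (u : algsol) : u *+ p \in firstint.
Proof.
apply/asboolP; split=> [|D _]; first exact: algsol_neq0.
have pchar_A : p \in [pchar A] by rewrite pchar_lalg.
rewrite algsol_valMn derfracX -mulr_natr -tofrac1 -tofracMn.
by rewrite (pcharf0 pchar_A) tofrac0 mulr0.
Qed.

Lemma quot_firstintMp (x : Quotient.quot firstint) : x *+ p = 0.
Proof.
elim/quotW: x => u; pose pi_ := \pi_(Quotient.quot firstint) : {additive _ -> _}.
rewrite -[LHS](raddfMn pi_) -(raddf0 pi_) /=.
by apply/eqP; rewrite -Quotient.idealrBE subr0 firstintMp.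
Qed.

(* The quotient Pi(A, DD), written additively, with its structure of a vector
   space over 'F_p; the scalar n%:R maps the class of f to the class of f ^+ n. *)
Definition Pi of p \in [pchar k] : Type := Quotient.quot firstint.

Local Notation V := (Pi pchar_k).

HB.instance Definition _ := GRing.Zmodule.on V.

Definition Pi_scale (a : 'F_p) (x : V) : V := x *+ a.

Fact Pi_scale_mod n (x : V) : x *+ (inZp n : 'F_p) = x *+ n.
Proof.
rewrite [in RHS](divn_eq n p) mulrnDr mulrnA mulrnAC (quot_firstintMp x) mul0rn add0r.
by rewrite /= (Fp_cast (pcharf_prime pchar_k)).
Qed.

Fact Pi_scaleA a b (x : V) : Pi_scale a (Pi_scale b x) = Pi_scale (a * b) x.
Proof. by rewrite /Pi_scale -mulrnA mulnC Pi_scale_mod. Qed.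
Fact Pi_scale1 : left_id 1 Pi_scale.
Proof. by move=> x; rewrite /Pi_scale Pi_scale_mod. Qed.
Fact Pi_scaleDr : right_distributive Pi_scale +%R.
Proof. by move=> a x y; rewrite /Pi_scale mulrnDl. Qed.
Fact Pi_scaleDl (x : V) : {morph Pi_scale^~ x : a b / a + b}.
Proof. by move=> a b; rewrite /Pi_scale Pi_scale_mod mulrnDr. Qed.

HB.instance Definition _ := GRing.Zmodule_isLmodule.Build 'F_p V
  Pi_scaleA Pi_scale1 Pi_scaleDr Pi_scaleDl.

End AlgebraicSolutions.

Definition finite_dimensional (K : fieldType) (V : lmodType K) : Prop :=
  exists n : nat, inhabited (Vector.axiom n V).

(* Main.v *)
Require Import Defs.
From HB Require Import structures.
From mathcomp Require Import all_boot all_algebra.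
From mathcomp Require Import boolp classical_sets.
From mathcomp Require Import mpoly zify.

(** Write K for the fraction field of A. To a solution f attach its logarithmic
    derivatives D f / f, which lie in A and vanish for all D exactly when f is a
    first integral. The classes of f_1, ..., f_N are therefore dependent over
    F_p as soon as their logarithmic derivatives are, and the point is to bound
    the number of independent systems of logarithmic derivatives.

    First enlarge the family of derivations by adding the iterates D^p, D^(p^2),
    ..., which are again derivations, for which f still has logarithmic
    derivatives in A. A derivation of K vanishing on constants is determined by
    its values on the n generators of A, so finitely many members E_1, ..., E_m
    of the enlarged family span it over K ([derivations_finite_span]). It
    suffices to control the vectors v = (E_i f / f)_i in A^m. Hochschild's
    formula ([hochschild_formula]) says that E f = a f implies
    E^p f = (a^p + E^(p-1) a) f; expanding E_i^p as a combination of the E_j, it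
    reads
      v_i ^ p = sum_j c_ij v_j - E_i^(p-1) v_i.
    The right-hand side is additive and commutes with multiplication by p-th
    powers, since derivations kill these. As K has finite dimension over its
    subfield of p-th powers, there is an additive kappa : K -> K with
    kappa (b^p u) = b kappa u and kappa 1 = 1 ([frobenius_splitting]). Applying
    it, v becomes a fixed point of an additive map L : K^m -> K^m such that
    L (b^p v) = b L v.

    Two facts about such a map L finish the proof.
    - It contracts degrees. An element of A of degree at most d in the generators
      is a combination of the monomials with exponents below p, whose
      coefficients are p-th powers of elements of degree at most d / p. So, up to
      a fixed denominator s, L maps degree d to degree d / p + c, and all its
      fixed points in A^m lie in s^-2 times a space of bounded degree, which has
      finite dimension over k ([fixed_points_bounded]).
    - Among fixed points of L, linear dependence over k implies dependence over
      F_p: apply L to a relation of minimal length normalised to have a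
      coefficient 1, and subtract ([semilinear_descent]). *)

Set Implicit Arguments.
Unset Strict Implicit.
Unset Printing Implicit Defensive.

Import GRing.Theory.
Local Open Scope ring_scope.

(** * Finite-dimensional linear algebra *)

Lemma homogeneous_system_solution (F : fieldType) (T : finType) N
    (C : 'I_N -> T -> F) :
  (#|T| < N)%N ->
  exists2 r : 'I_N -> F, exists i, r i != 0 & forall t, \sum_i r i * C i t = 0.
Proof.
move=> ltTN; pose M := \matrix_(i < N, j < #|T|) C i (enum_val j).
have kM : kermx M != 0.
  rewrite -mxrank_eq0 mxrank_ker subn_eq0 -ltnNge.
  exact: leq_ltn_trans (rank_leq_col M) ltTN.
have /rowV0Pn[u /sub_kermxP uM u0] := kM.
exists (u 0) => [|t].
  apply/existsP; apply: contraNT u0 => /existsPn u0.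
  apply/eqP/rowP => i; rewrite mxE; exact/eqP/negPn/u0.
have := congr1 (fun v : 'rV_#|T| => v 0 (enum_rank t)) uM.
rewrite !mxE => E; rewrite -[RHS]E; apply: eq_bigr => i _.
by rewrite mxE enum_rankK.
Qed.

(** Coordinates on a linearly independent family of maximal length, which spans
    because adding any vector to it creates a relation. *)
Lemma finite_dimensional_of_dependent (F : fieldType) (V : lmodType F) N :
  (forall y : 'I_N -> V, exists2 r : 'I_N -> F,
     exists i, r i != 0 & \sum_i r i *: y i = 0) ->
  finite_dimensional V.
Proof.
pose free m (y : 'I_m -> V) :=
  forall r : 'I_m -> F, \sum_i r i *: y i = 0 -> forall i, r i = 0.
move=> depN.
have lt_free m : `[< exists y : 'I_m -> V, free m y >] -> (m <= N)%N.
  move=> /asboolP[y fy]; rewrite leqNgt; apply/negP => ltNm.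
  have [r [i ri0] r0] := depN (fun i => y (widen_ord (ltnW ltNm) i)).
  pose r' (j : 'I_m) := if insub (val j) is Some i then r i else 0.
  case/eqP: ri0; have := fy r' _ (widen_ord (ltnW ltNm) i).
  rewrite /r' /= valK; apply.
  rewrite -[RHS]r0; 
  pose G j :=
    if insub j is Some i then r i *: y (widen_ord (ltnW ltNm) i) else 0.
  transitivity (\sum_(j < m) G j).
    apply: eq_bigr => j _; rewrite /G; case: insubP => [i0 _ i0j|]; last by rewrite scale0r.
    by congr (_ *: y _); apply: val_inj.
  rewrite -(big_mkord xpredT G) (big_cat_nat _ (n := N)) ?(ltnW ltNm) //=.
  rewrite [X in _ + X]big_nat_cond [X in _ + X]big1 ?addr0 ?big_mkord.
    by apply: eq_bigr => j _; rewrite /G valK.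
  by move=> j /andP[/andP[leNj _] _]; rewrite /G insubN // -leqNgt.
have ex0 : exists m, `[< exists y : 'I_m -> V, free m y >].
  by exists 0; apply/asboolP; exists (fun=> 0) => r _ [].
case: (ex_maxnP ex0 lt_free) => m /asboolP[y fy] maxm; exists m.
have span v : exists r : 'rV[F]_m, \sum_i r 0 i *: y i == v.
  have [//|nspan] := EM (exists r : 'rV[F]_m, \sum_i r 0 i *: y i == v).
  have /maxm : `[< exists y : 'I_m.+1 -> V, free m.+1 y >]; last by rewrite ltnn.
  apply/asboolP; exists (fun i => oapp y v (unlift ord0 i)) => r.
  rewrite big_ord_recl unlift_none /= => E.
  have r0 : r ord0 = 0.
    apply/eqP/negPn/negP => r0; apply: nspan.
    exists (\row_i (- (r ord0)^-1 * r (lift ord0 i))); apply/eqP.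
    apply: (scalerI r0); rewrite scaler_sumr -(subr0 (_ *: v)).
    rewrite -[in RHS]E opprD addNKr -sumrN.
    apply: eq_bigr => i _; rewrite liftK mxE scalerA mulrA mulrN mulfV //.
    by rewrite mulN1r scaleNr.
  move=> i; have [j ->|-> //] := unliftP ord0 i.
  apply: (fy (fun j => r (lift ord0 j))); rewrite -[RHS]E r0 scale0r add0r.
  by apply: eq_bigr => l _; rewrite liftK.
pose f (r : 'rV[F]_m) := \sum_i r 0 i *: y i.
pose g v : 'rV[F]_m := xchoose (span v).
have gK : cancel g f by move=> v; apply/eqP/(xchooseP (span v)).
have f_lin : linear f.
  move=> a u v; rewrite /f scaler_sumr -big_split /=; apply: eq_bigr => i _.
  by rewrite !mxE scalerDl scalerA.
have f_inj : injective f.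
  move=> u v fuv; apply/eqP; rewrite -subr_eq0; apply/eqP/rowP => i.
  rewrite [RHS]mxE; apply: (fy ((u - v) 0)); rewrite -[LHS]/(f (u - v)).
  by rewrite addrC -scaleN1r f_lin fuv scaleN1r addNr.
constructor; exists g; last by exists f => // r; apply: f_inj; rewrite gK.
by move=> a u v; apply: f_inj; rewrite f_lin !gK.
Qed.

(** Rows chosen in P so that the rank is maximal: one more row of P cannot raise
    it. *)
Lemma finite_spanning_rows (F : fieldType) n (P : set 'rV[F]_n) :
  exists m, exists2 W : 'M[F]_(m, n), forall i, P (row i W) &
    forall w, P w -> (w <= W)%MS.
Proof.
pose Q r := `[< exists m, exists2 W : 'M[F]_(m, n),
                 forall i, P (row i W) & \rank W = r >].
have Qbound r : Q r -> (r <= n)%N.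
  by move=> /asboolP[m [W _ <-]]; exact: rank_leq_col.
have ex0 : exists r, Q r.
  by exists 0; apply/asboolP; exists 0, 0; [case | rewrite mxrank0].
case: (ex_maxnP ex0 Qbound) => r /asboolP[m [W PW rkW]] maxr.
exists m, W => // w Pw.
have sWw : (W <= col_mx W w)%MS by rewrite -addsmxE addsmxSl.
have : (col_mx W w <= W)%MS.
  rewrite -(geq_leqif (mxrank_leqif_sup sWw)) rkW; apply: maxr; apply/asboolP.
  exists (m + 1)%N, (col_mx W w) => // i.
  by case: (split_ordP i) => j ->; rewrite ?rowKu ?rowKd // ord1 row_id.
by rewrite col_mx_sub => /andP[].
Qed.

(** * Frobenius-semilinear maps and their fixed points *)

Section FrobeniusPower.
Variables (p : nat) (R : comNzRingType) (pcharR : p \in [pchar R]).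

Lemma expr_pD (x y : R) : (x + y) ^+ p = x ^+ p + y ^+ p.
Proof. exact: (rmorphD (pFrobenius_aut pcharR)). Qed.

Lemma expr_p_sum I (s : seq I) (P : pred I) (F : I -> R) :
  (\sum_(i <- s | P i) F i) ^+ p = \sum_(i <- s | P i) F i ^+ p.
Proof. exact: (rmorph_sum (pFrobenius_aut pcharR)). Qed.
End FrobeniusPower.

(** The p classes n%:R already exhaust the roots of X^p - X. *)
Lemma frobenius_fixed p (k : fieldType) (pchark : p \in [pchar k]) (c : k) :
  c ^+ p = c -> exists n : nat, c = n%:R.
Proof.
move=> cp; have p_gt1 := prime_gt1 (pcharf_prime pchark).
pose q : {poly k} := 'X^p - 'X.
have szq : size q = p.+1.
  by rewrite /q size_polyDl ?size_polyXn // size_polyN size_polyX.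
pose s := [seq i%:R : k | i <- iota 0 p].
have [/mapP[i _ ->]|cNs] := boolP (c \in s); first by exists i.
have : (size (c :: s) < size q)%N.
  apply: max_poly_roots.
  - by rewrite -size_poly_gt0 szq.
  - rewrite /= rootE !hornerE cp subrr eqxx /=; apply/allP => _ /mapP[i _ ->].
    rewrite rootE !hornerE subr_eq0; apply/eqP.
    exact: (pFrobenius_aut_nat pchark i).
  rewrite /= cNs map_inj_in_uniq ?iota_uniq // => i j.
  rewrite !mem_iota /= => ltip ltjp /eqP.
  wlog leij : i j ltip ltjp / (i <= j)%N.
    move=> W; case: (leqP i j) => [|/ltnW] le; first exact: W.
    by rewrite eq_sym => /(W j i ltjp ltip le) ->.
  rewrite eq_sym -subr_eq0 -natrB // -(dvdn_pcharf pchark) => dv.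
  apply/eqP; rewrite eqn_leq leij -subn_eq0 /=; apply/negPn/negP.
  rewrite -lt0n => /dvdn_leq/(_ dv) le.
  by have := leq_ltn_trans (leq_trans le (leq_subr i j)) ltjp; rewrite ltnn.
by rewrite szq /= size_map size_iota ltnn.
Qed.

Section FrobeniusDescent.
Variables (p : nat) (k K : fieldType) (iota : {rmorphism k -> K}).
Hypotheses (pchark : p \in [pchar k])
  (perfect : forall c : k, exists d, c = d ^+ p).
Variables (V : lmodType K) (L : V -> V).
Hypotheses (LD : {morph L : u v / u + v})
  (LZ : forall b v, L (b ^+ p *: v) = b *: L v).

Lemma semilinear_sum I (s : seq I) (F : I -> V) :
  L (\sum_(i <- s) F i) = \sum_(i <- s) L (F i).
Proof.
apply: (big_morph L LD); have := LD 0 0; rewrite addr0 => E.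
by apply: (addrI (L 0)); rewrite -E addr0.
Qed.

(** Fixed points of L behave like the F_p-points of an F_p-structure. If
    sum r_i v_i = 0 with r_i0 = 1, applying L gives sum m_i v_i = 0 with
    m_i^p = r_i, and the difference of the two relations is shorter; so a
    relation of minimal length has r_i = m_i = r_i^p, that is, r_i in F_p. *)
Lemma semilinear_descent N (v : 'I_N -> V) (r : 'I_N -> k) :
  (forall i, L (v i) = v i) -> (exists i, r i != 0) ->
  \sum_i iota (r i) *: v i = 0 ->
  exists2 z : 'I_N -> nat, exists i, (z i)%:R != 0 :> k & \sum_i v i *+ z i = 0.
Proof.
move=> Lv; have [B] := ubnP #|[pred i | r i != 0]|.
elim: B => // B IH in r *; rewrite ltnS => leB [i0 ri0] Er.
have {leB ri0 Er} [{}r [r1 leB Er]] : exists r : 'I_N -> k,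
    [/\ r i0 = 1, (#|[pred i | r i != 0%R]| <= B)%N &
        \sum_i iota (r i) *: v i = 0].
  exists (fun i => (r i0)^-1 * r i); split; first exact: mulVf.
    rewrite (eq_card (B := [pred i | r i != 0])) // => i.
    by rewrite !inE mulf_eq0 invr_eq0 (negbTE ri0).
  transitivity (iota ((r i0)^-1) *: \sum_i iota (r i) *: v i); last by rewrite Er scaler0.
  by rewrite scaler_sumr; apply: eq_bigr => i _ /=; rewrite rmorphM scalerA.
have /choice[m rm] := fun i => perfect (r i).
have Em : \sum_i iota (m i) *: v i = 0.
  have L0 : L 0 = 0 by have := semilinear_sum [::] (fun i : nat => 0); rewrite !big_nil.
  rewrite -[RHS]L0 -[X in _ = L X]Er semilinear_sum; apply: eq_bigr => i _.
  by rewrite rm rmorphXn LZ Lv.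
have E : \sum_i iota (r i - m i) *: v i = 0.
  transitivity (\sum_i iota (r i) *: v i - \sum_i iota (m i) *: v i); last by rewrite Er Em subr0.
  by rewrite -sumrB; apply: eq_bigr => i _; rewrite rmorphB scalerBl.
have [[j rmj]|same] := EM (exists j, r j - m j != 0).
  apply: (IH (fun i => r i - m i)) E; last by exists j.
  apply: leq_trans leB; apply/proper_card/properP; split.
    apply/fintype.subsetP => i; rewrite !inE; apply: contra => /eqP ri.
    have mi : m i == 0.
      have := rm i; rewrite ri => /esym/eqP; rewrite expf_eq0 => /andP[_]; exact.
    by rewrite ri (eqP mi) subrr.
  exists i0; rewrite !inE r1 ?oner_eq0 //= negbK subr_eq0; apply/eqP.
  suff: 1 ^+ p = m i0 ^+ p by move/(fmorph_inj (pFrobenius_aut pchark)).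
  by rewrite -rm r1 expr1n.
have /choice[z rz] i : exists n : nat, r i = n%:R.
  apply: (frobenius_fixed pchark).
  suff {1}-> : r i = m i by rewrite -rm.
  by apply/eqP; rewrite -subr_eq0; apply/negPn/negP => ?; apply: same; exists i.
exists z; first by exists i0; rewrite -rz r1 oner_eq0.
by rewrite -[RHS]Er; apply: eq_bigr => i _; rewrite rz rmorph_nat scaler_nat.
Qed.
End FrobeniusDescent.

Section DerivationPower.
Variables (K : fieldType) (D : K -> K).
Hypotheses (DD : {morph D : f g / f + g})
  (DM : forall f g, D (f * g) = D f * g + f * D g).

Lemma derivation0 : D 0 = 0.
Proof. by apply: (addrI (D 0)); rewrite -DD !addr0. Qed.

Lemma derivation1 : D 1 = 0.
Proof. by apply: (addrI (D 1)); rewrite -{3}[1]mulr1 DM mulr1 mul1r addr0. Qed.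

Lemma derivation_sum I (s : seq I) (P : pred I) (F : I -> K) :
  D (\sum_(i <- s | P i) F i) = \sum_(i <- s | P i) D (F i).
Proof. exact: (big_morph D DD derivation0). Qed.

Lemma derivationMn f n : D (f *+ n) = D f *+ n.
Proof. by elim: n => [|n IHn]; rewrite ?mulr0n ?derivation0 // !mulrS DD IHn. Qed.

Lemma iter_derivationD n : {morph iter n D : f g / f + g}.
Proof. by elim: n => // n IHn f g; rewrite /= IHn DD. Qed.

Lemma iter_derivationM n f g :
  iter n D (f * g) = \sum_(i < n.+1) (iter i D f * iter (n - i) D g) *+ 'C(n, i).
Proof.
elim: n => [|n IHn]; first by rewrite big_ord_recl big_ord0 addr0.
rewrite /= IHn derivation_sum.
transitivity (\sum_(i < n.+1) ((iter i.+1 D f * iter (n - i) D g) *+ 'C(n, i) +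
    (iter i D f * iter (n.+1 - i) D g) *+ 'C(n, i))).
  by apply: eq_bigr => i _; rewrite derivationMn DM mulrnDl subSn // -ltnS.
rewrite big_split /= [X in X + _]big_ord_recr [X in _ + X]big_ord_recl.
rewrite [RHS]big_ord_recl [X in _ = _ + X]big_ord_recr /=.
rewrite /bump /= !add1n !bin0 !binn subSS subnn addrC -!addrA; congr (_ + _).
rewrite addrA; congr (_ + _); rewrite -big_split /=; apply: eq_bigr => i _.
by rewrite /bump /= !add1n subSS binS mulrnDr addrC.
Qed.

Variables (p : nat) (pcharK : p \in [pchar K]).

Lemma pth_iter_derivationM f g :
  iter p D (f * g) = iter p D f * g + f * iter p D g.
Proof.
have := prime_gt0 (pcharf_prime pcharK); move: p pcharK => [//|n] pcharK' _.
rewrite iter_derivationM big_ord_recl big_ord_recr /= /bump /= !add1n subnn bin0 binn.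
rewrite big1 => [|i _]; first by rewrite add0r addrC.
rewrite -mulr_natr (_ : _%:R = 0) ?mulr0 //.
by apply: (bin_lt_pcharf_0 pcharK'); rewrite /= /bump /= add1n !ltnS.
Qed.

Lemma derivationXp f : D (f ^+ p) = 0.
Proof.
suff E n : D (f ^+ n) = f ^+ n.-1 * D f *+ n.
  by rewrite E -mulr_natr (pcharf0 pcharK) mulr0.
elim: n => [|[|n] IHn]; first by rewrite expr0 derivation1.
  by rewrite expr1 mul1r.
by rewrite exprS DM IHn /= mulrnAr mulrA -exprS [D f * _]mulrC -mulrS.
Qed.

Section Hochschild.
Variable a : K.
(** The operator D + t a on K[t], where t is the variable 'X and D acts on
    coefficients. Its n-th iterate on 1 is the polynomial F n; for D f = a f, the
    value of F n at t = 1 is the factor of f in D^n f. *)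
Definition twist (q : {poly K}) := map_poly D q + a *: ('X * q).
Local Notation F n := (iter n twist 1).

Let coef_twist0 q : (twist q)`_0 = D q`_0.
Proof. by rewrite coefD coefZ coefXM mulr0 addr0 coef_map_id0 ?derivation0. Qed.

Let coef_twistS q i : (twist q)`_i.+1 = D q`_i.+1 + a * q`_i.
Proof. by rewrite coefD coefZ coefXM coef_map_id0 ?derivation0. Qed.

Let twistD : {morph twist : q s / q + s}.
Proof.
move=> q s; apply/polyP => -[|i]; first by rewrite coefD !coef_twist0 coefD DD.
by rewrite coefD !coef_twistS !coefD DD mulrDr addrACA.
Qed.

Let twistZ b q : twist (b *: q) = D b *: q + b *: twist q.
Proof.
apply/polyP => -[|i].
  by rewrite coef_twist0 coefZ DM [RHS]coefD !coefZ coef_twist0.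
by rewrite coef_twistS [RHS]coefD !coefZ coef_twistS DM mulrDr addrA (mulrCA a).
Qed.

Let twistMn q n : twist (q *+ n) = twist q *+ n.
Proof.
elim: n => [|n IHn]; last by rewrite !mulrS twistD IHn.
by apply: (addrI (twist 0)); rewrite -twistD !addr0.
Qed.

Let twist_sum I (s : seq I) (G : I -> {poly K}) :
  twist (\sum_(i <- s) G i) = \sum_(i <- s) twist (G i).
Proof. by apply: (big_morph twist twistD); have := twistMn 0 0; rewrite !mulr0n. Qed.

Let deriv_twist q : (twist q)^`() = twist q^`() + a *: q.
Proof.
apply/polyP => i; rewrite coef_deriv coef_twistS mulrnDl coefD coefZ.
case: i => [|i]; first by rewrite coef_twist0 coef_deriv -derivationMn.
rewrite coef_twistS !coef_deriv -derivationMn -addrA; congr (_ + _).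
by rewrite -mulrnAr mulrS mulrDr addrC.
Qed.

(** Formally a = D u and F n = exp(- t u) D^n exp(t u), whose derivative in t is
    exp(- t u) D^n (u exp(t u)) - u F n; the formula is Leibniz's rule for the
    first term. *)
Lemma deriv_twist_iter n : (F n)^`() =
  \sum_(j < n) (iter j D a *: F (n - j.+1)%N) *+ 'C(n, j.+1).
Proof.
elim: n => [|n IHn]; first by rewrite big_ord0 /= -[1]/(1%:P) derivC.
rewrite /= deriv_twist IHn twist_sum.
transitivity (\sum_(j < n) ((iter j.+1 D a *: F (n - j.+1)%N) *+ 'C(n, j.+1) +
    (iter j D a *: F (n - j)%N) *+ 'C(n, j.+1)) + a *: F n).
  congr (_ + _); apply: eq_bigr => j _.
  by rewrite twistMn twistZ mulrnDl -(subnSK (ltn_ord j)).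
under [RHS]eq_bigr => j _ do rewrite subSS binS mulrnDr.
rewrite !big_split /= [X in _ = X + _]big_ord_recr [X in _ = _ + X]big_ord_recl /=.
rewrite (bin_small (ltnSn n)) mulr0n addr0 bin0 subn0.
by rewrite addrAC addrC (addrC _ (a *: _)).
Qed.

Let coef_twist_iter n i : (n <= i)%N -> (F n)`_i = a ^+ n *+ (n == i).
Proof.
elim: n i => [|n IHn] [|i] //; rewrite ?coef1 //= ltnS => leni.
rewrite coef_twistS !IHn ?leqW // (ltn_eqF (leni : n < i.+1)%N) derivation0 add0r.
by rewrite mulrnAr -exprS eqSS.
Qed.

Let coef0_twist_iter n : (F n.+1)`_0 = 0.
Proof.
elim: n => [|n IHn]; rewrite /= coef_twist0 ?IHn ?derivation0 //.
by rewrite coef1 derivation1.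
Qed.

Let twist_horner1 q : (twist q).[1] = D q.[1] + a * q.[1].
Proof.
rewrite hornerD hornerZ hornerM hornerX mul1r; congr (_ + _).
rewrite /map_poly horner_poly horner_coef derivation_sum.
by apply: eq_bigr => i _; rewrite expr1n !mulr1.
Qed.

Let iter_eigen f n : D f = a * f -> iter n D f = (F n).[1] * f.
Proof.
move=> Df; elim: n => [|n IHn]; first by rewrite hornerE mul1r.
by rewrite !iterS IHn DM Df twist_horner1 mulrDl mulrA (mulrC _ a).
Qed.

(** In characteristic p only the last term of the derivative of F p survives, so
    that this derivative is the constant D^(p-1) a. This determines F p up to its
    coefficients in degrees 0 and p, which are 0 and a^p. *)
Lemma hochschild_formula f :
  D f = a * f -> iter p D f = (a ^+ p + iter p.-1 D a) * f.
Proof.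
move=> /iter_eigen ->; congr (_ * _).
have coefF : forall i, (p <= i)%N -> (F p)`_i = a ^+ p *+ (p == i).
  by move=> i; exact: coef_twist_iter.
move: (deriv_twist_iter p) (pcharf_prime pcharK) pcharK coefF.
case: p => [//|[//|n]] dF _ pK coefF.
move: (coef0_twist_iter n.+1) coefF dF; move: (F n.+2) => G G0 coefF.
have szF := coefF _ (leqnn _).
rewrite big_ord_recr big1 /= => [|j _]; last first.
  rewrite -mulr_natr (_ : _%:R = 0) ?mulr0 //.
  rewrite -polyC_natr (bin_lt_pcharf_0 pK) //= ltnS ltn_ord //.
rewrite add0r binn subnn => dF.
rewrite (@horner_coef_wide _ n.+3); last first.
  apply/leq_sizeP => i lei; rewrite coefF ?(ltnW lei) //.
  by rewrite (ltn_eqF lei).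
rewrite big_ord_recr big_ord_recl /= szF G0 mul0r add0r.
rewrite expr1n mulr1 addrC eqxx; congr (_ + _).
rewrite big_ord_recl big1 /= => [|i _].
  rewrite expr1n mulr1 addr0; have := congr1 (fun q : {poly K} => q`_0) dF.
  by rewrite coef_deriv coefZ coef1 mulr1.
have := congr1 (fun q : {poly K} => q`_i.+1) dF.
rewrite coef_deriv coefZ coef1 mulr0 -mulr_natr => /eqP.
rewrite mulf_eq0 -(dvdn_pcharf pK) gtnNdvd ?orbF // => [/eqP|].
  by rewrite /bump /= !add1n => ->; rewrite mul0r.
by rewrite !ltnS.
Qed.

End Hochschild.
End DerivationPower.

(** * Degree in the generators, and p-th roots *)

Section Filtration.
Variables (k K : fieldType) (iota : {rmorphism k -> K}) (n : nat) (x : 'I_n -> K).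

Definition deg_le d (u : K) : Prop :=
  exists2 q : {mpoly k[n]}, (msize q <= d.+1)%N & u = mmap iota x q.

Lemma deg_leW d e u : (d <= e)%N -> deg_le d u -> deg_le e u.
Proof. by move=> le [q sq ->]; exists q => //; apply: leq_trans sq _. Qed.

Lemma deg_leD d u v : deg_le d u -> deg_le d v -> deg_le d (u + v).
Proof.
move=> [q sq ->] [r sr ->]; exists (q + r); last by rewrite mmapD.
by apply: leq_trans (msizeD_le _ _) _; rewrite geq_max sq.
Qed.

Lemma deg_leM d e u v : deg_le d u -> deg_le e v -> deg_le (d + e) (u * v).
Proof.
move=> [q sq ->] [r sr ->]; exists (q * r); last by rewrite rmorphM.
have [->|q0] := eqVneq q 0; first by rewrite mul0r msize0.
have [->|r0] := eqVneq r 0; first by rewrite mulr0 msize0.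
rewrite msizeM // -subn1 leq_subLR; apply: leq_trans (leq_add sq sr) _.
by rewrite addSn addnS add1n.
Qed.

Lemma deg_leC d c : deg_le d (iota c).
Proof.
exists c%:MP; last by rewrite mmapC.
by rewrite msizeC; case: eqP.
Qed.

Lemma deg_le0 d : deg_le d 0. Proof. by rewrite -(rmorph0 iota); exact: deg_leC. Qed.
Lemma deg_le1 d : deg_le d 1. Proof. by rewrite -(rmorph1 iota); exact: deg_leC. Qed.

Lemma deg_le_sum d I (s : seq I) (F : I -> K) :
  (forall i, deg_le d (F i)) -> deg_le d (\sum_(i <- s) F i).
Proof.
by move=> dF; apply: (big_ind (deg_le d)) => //; [exact: deg_le0|exact: deg_leD].
Qed.

Lemma deg_leX d u m : deg_le d u -> deg_le (m * d) (u ^+ m).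
Proof.
move=> du; elim: m => [|m IHm]; first exact: deg_le1.
by rewrite exprS mulSn; exact: deg_leM.
Qed.

Lemma deg_le_mmap1 (m : 'X_{1..n}) : deg_le (mdeg m) (mmap1 x m).
Proof. by exists 'X_[m]; rewrite ?msizeX // mmapX. Qed.

Lemma deg_le_ind (P : K -> Prop) d :
  P 0 -> (forall u v, P u -> P v -> P (u + v)) ->
  (forall c (m : 'X_{1..n}), (mdeg m <= d)%N -> P (iota c * mmap1 x m)) ->
  forall u, deg_le d u -> P u.
Proof.
move=> P0 PD PM _ [q sq ->]; rewrite (mpolywE sq) raddf_sum /=.
apply: (big_ind P) => // m _; rewrite mmapZ mmapX; apply: PM.
by rewrite -ltnS bmdeg.
Qed.

Variables (p : nat) (pchark : p \in [pchar k]).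
Hypothesis perfect : forall c : k, exists d, c = d ^+ p.

Let pcharK : p \in [pchar K]. Proof. exact: (rmorph_pchar iota). Qed.
Let p_gt0 : (0 < p)%N. Proof. exact: prime_gt0 (pcharf_prime pcharK). Qed.

Definition p_monomial (e : {ffun 'I_n -> 'I_p}) : K := \prod_i x i ^+ e i.

(** Divide every exponent by p with remainder; the scalars have p-th roots as k
    is perfect. *)
Lemma deg_le_pth_roots d u : deg_le d u ->
  exists2 w : {ffun 'I_n -> 'I_p} -> K, forall e, deg_le (d %/ p) (w e) &
    u = \sum_e w e ^+ p * p_monomial e.
Proof.
pose P u := exists2 w : {ffun 'I_n -> 'I_p} -> K,
  forall e, deg_le (d %/ p) (w e) & u = \sum_e w e ^+ p * p_monomial e.
move: u; apply: (deg_le_ind (P := P)).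
- exists (fun=> 0) => [e|]; first exact: deg_le0.
  by rewrite big1 // => e _; rewrite expr0n eqn0Ngt p_gt0 mul0r.
- move=> u v [w dw ->] [z dz ->]; exists (fun e => w e + z e) => [e|].
    exact: deg_leD.
  by rewrite -big_split /=; apply: eq_bigr => e _; rewrite (expr_pD pcharK) mulrDl.
move=> c m dm; have [b ->] := perfect c.
pose e0 := [ffun i => Ordinal (ltn_pmod (m i) p_gt0)].
pose m0 := [multinom (m i %/ p)%N | i < n].
exists (fun e => if e == e0 then iota b * mmap1 x m0 else 0) => [e|].
  case: eqP => _; last exact: deg_le0.
  apply: (@deg_leW (0 + mdeg m0)); last first.
    exact: (deg_leM (deg_leC 0 b) (deg_le_mmap1 m0)).
  rewrite add0n leq_divRL //; apply: leq_trans dm; rewrite !mdegE big_distrl /=.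
  by apply: leq_sum => i _; rewrite mnmE leq_trunc_div.
rewrite (bigD1 e0) //= eqxx big1 => [|e /negbTE ->]; last first.
  by rewrite expr0n eqn0Ngt p_gt0 mul0r.
rewrite addr0 exprMn rmorphXn -mulrA; congr (_ * _).
rewrite /mmap1 /p_monomial -prodrXl -big_split /=; apply: eq_bigr => i _.
by rewrite mnmE ffunE /= -exprM -exprD -divn_eq.
Qed.

Hypothesis frac : forall f, exists d a b,
  [/\ deg_le d a, deg_le d b, b != 0 & f = a / b].

Lemma common_denominator (s : seq K) :
  exists c d, [/\ c != 0, deg_le d c & forall y, y \in s -> deg_le d (c * y)].
Proof.
elim: s => [|y s [c [d [c0 dc ds]]]].
  by exists 1, 0; split; [exact: oner_neq0 | exact: deg_le1 | ].
have [e [a [b [da db b0 yE]]]] := frac y.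
exists (c * b), (d + e)%N; split=> [||z]; first exact: mulf_neq0.
  exact: deg_leM.
rewrite inE => /predU1P[->|zs].
  by rewrite yE -mulrA (mulrC b) mulfVK //; exact: deg_leM.
by rewrite mulrAC; apply: deg_leM => //; exact: ds.
Qed.

(** Multiplying a / b by b^p makes it a polynomial in the generators. *)
Lemma p_monomial_span f :
  exists w : {ffun 'I_n -> 'I_p} -> K, f = \sum_e w e ^+ p * p_monomial e.
Proof.
have [d [a [b [da db b0 ->]]]] := frac f.
have [w _ wE] := deg_le_pth_roots (deg_leM da (deg_leX p.-1 db)).
exists (fun e => w e / b); apply: (@mulIf _ (b ^+ p)); first by rewrite expf_neq0.
have bp : b ^+ p = b * b ^+ p.-1 by rewrite -exprS prednK.
rewrite mulr_suml {1}bp mulrA mulfVK // wE.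
by apply: eq_bigr => e _; rewrite expr_div_n mulrAC mulfVK ?expf_neq0.
Qed.
End Filtration.

(** K as a vector space over itself through b . u = b^p u, that is, K as a vector
    space over its subfield of p-th powers. *)
Definition frobenius_module (p : nat) (K : fieldType) of p \in [pchar K] : Type := K.

Section FrobeniusModule.
Variables (p : nat) (K : fieldType) (pcharK : p \in [pchar K]).
Local Notation V := (frobenius_module pcharK).
HB.instance Definition _ := GRing.Zmodule.on V.
Definition frobenius_scale (b : K) (u : V) : V := b ^+ p * (u : K).
Fact frobenius_scaleA a b u :
  frobenius_scale a (frobenius_scale b u) = frobenius_scale (a * b) u.
Proof. by rewrite /frobenius_scale exprMn mulrA. Qed.
Fact frobenius_scale1 : left_id 1 frobenius_scale.
Proof. by move=> u; rewrite /frobenius_scale expr1n mul1r. Qed.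
Fact frobenius_scaleDr : right_distributive frobenius_scale +%R.
Proof. by move=> a u v; exact: mulrDr. Qed.
Fact frobenius_scaleDl u : {morph frobenius_scale^~ u : a b / a + b}.
Proof. by move=> a b; rewrite /frobenius_scale (expr_pD pcharK) mulrDl. Qed.
HB.instance Definition _ := GRing.Zmodule_isLmodule.Build K V
  frobenius_scaleA frobenius_scale1 frobenius_scaleDr frobenius_scaleDl.

(** A linear form on K, seen as a vector space through Frobenius, that does not
    vanish at 1: a coordinate at which 1 is nonzero, rescaled. *)
Lemma frobenius_splitting (T : finType) (y : T -> K) :
  (forall f, exists w : T -> K, f = \sum_t w t ^+ p * y t) ->
  exists2 kappa : K -> K, {morph kappa : u v / u + v} &
    (forall b u, kappa (b ^+ p * u) = b * kappa u) /\ kappa 1 = 1.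
Proof.
move=> span.
have [|d [[h h_lin h_bij]]] := @finite_dimensional_of_dependent K V #|T|.+1.
  move=> u; have /choice[w wE] := fun i => span (u i).
  have [r r0 rE] := homogeneous_system_solution w (ltnSn #|T|); exists r => //.
  transitivity (\sum_i \sum_t (r i * w i t) ^+ p * y t : K).
    apply: eq_bigr => i _; rewrite -[LHS]/(r i ^+ p * (u i : K)) wE mulr_sumr.
    by apply: eq_bigr => t _; rewrite exprMn mulrA.
  rewrite exchange_big big1 //= => t _.
  rewrite -mulr_suml -(expr_p_sum pcharK) rE expr0n eqn0Ngt.
  by rewrite prime_gt0 ?(pcharf_prime pcharK) ?mul0r.
have h0 : h 0 = 0 by have := h_lin (-1) 0 0; rewrite !scaleN1r !addNr.
have [j hj] : exists j, h (1 : K) 0 j != 0.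
  apply/existsP; apply: contraT => /existsPn h1.
  case/eqP: (oner_neq0 K); apply: (bij_inj h_bij); rewrite h0; apply/rowP => j.
  by rewrite [RHS]mxE; exact/eqP/negPn/h1.
exists (fun u => h u 0 j / h (1 : K) 0 j) => [u v|].
  by have := h_lin 1 u v; rewrite !scale1r => ->; rewrite mxE mulrDl.
split=> [b u|]; last exact: mulfV.
have := h_lin b u 0; rewrite addr0 h0 addr0 => E.
by rewrite [h _](_ : _ = b *: h u) // mxE mulrA.
Qed.
End FrobeniusModule.

(** * Boundedness of integral fixed points *)

Section SemilinearFixedPoints.
Variables (k K : fieldType) (iota : {rmorphism k -> K}) (n : nat) (x : 'I_n -> K).
Variables (p : nat) (pchark : p \in [pchar k]).
Hypothesis perfect : forall c : k, exists d, c = d ^+ p.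
Local Notation deg_le := (deg_le iota x).
Hypothesis frac : forall f, exists d a b,
  [/\ deg_le d a, deg_le d b, b != 0 & f = a / b].
Variables (m : nat) (L : 'rV[K]_m -> 'rV[K]_m).
Hypotheses (LD : {morph L : u v / u + v})
  (LZ : forall b v, L (b ^+ p *: v) = b *: L v).

(** L is determined by its values on the finitely many vectors
    p_monomial e *: delta_mx 0 j; s is a common denominator of these. *)
Lemma semilinear_contracts : exists s c, [/\ s != 0, deg_le c s &
  forall d (v : 'rV[K]_m), (forall j, deg_le d (v 0 j)) ->
    forall l, deg_le (d %/ p + c) (s * L v 0 l)].
Proof.
pose Y (t : {ffun 'I_n -> 'I_p} * 'I_m * 'I_m) :=
  L (p_monomial x t.1.1 *: delta_mx 0 t.1.2) 0 t.2.
have [s [c [s0 ds dY]]] := common_denominator frac (codom Y).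
exists s, c; split=> // d v dv l.
have /choice[w wE] j : exists w : {ffun 'I_n -> 'I_p} -> K,
    (forall e, deg_le (d %/ p) (w e)) /\
    v 0 j = \sum_e w e ^+ p * p_monomial x e.
  by have [w] := deg_le_pth_roots pchark perfect (dv j); exists w.
have -> : v = \sum_j \sum_e w j e ^+ p *: (p_monomial x e *: delta_mx 0 j).
  rewrite [v in LHS]row_sum_delta; apply: eq_bigr => j _.
  rewrite (wE j).2 scaler_suml; apply: eq_bigr => e _.
  by rewrite scalerA.
rewrite (semilinear_sum LD) summxE mulr_sumr; apply: deg_le_sum => j.
rewrite (semilinear_sum LD) summxE mulr_sumr; apply: deg_le_sum => e.
rewrite LZ mxE mulrCA; apply: deg_leM; first exact: (wE j).1.
by apply: dY; apply/codomP; exists (e, j, l).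
Qed.

(** If s^2 v has degree at most d, then so does, up to the bounded degree of
    s^(p-2), the vector s^p v, and L (s^p v) = s v for a fixed point v. Hence
    s^2 v = s L (s^p v) has degree about d / p. A denominator s^N is reproduced in
    this way when N <= p M and M + 1 <= N for some M; N = 2 with M = 1 serves for
    all p. *)
Lemma fixed_points_bounded : exists s d, s != 0 /\
  forall v, L v = v -> (forall j, exists e, deg_le e (v 0 j)) ->
    forall j, deg_le d (s ^+ 2 * v 0 j).
Proof.
have [s [c [s0 ds Ldeg]]] := semilinear_contracts.
have p_gt1 : (1 < p)%N by exact: prime_gt1 (pcharf_prime pchark).
exists s, (4 * c)%N; split=> // v Lv v_int.
have [d] : exists d, forall j, deg_le d (s ^+ 2 * v 0 j).
  have /choice[e ve] := v_int; exists (2 * c + \max_j e j)%N => j.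
  apply: deg_leM; first exact: deg_leX.
  by apply: deg_leW (ve j); exact: leq_bigmax.
elim/ltn_ind: d => d IH dv; have [le|lt] := leqP d (4 * c).
  by move=> j; exact: deg_leW (dv j).
apply: (IH (((p - 2) * c + d) %/ p + c)%N) => [|j].
  (* d / 2 + 2 c < d, as d > 4 c *)
  have : (((p - 2) * c + d) %/ p <= c + d %/ 2)%N.
    apply: (@leq_trans ((c * p + d) %/ p)); first by apply: leq_div2r; nia.
    by rewrite divnMDl ?(ltnW p_gt1) // leq_add2l leq_div2l.
  by move=> ?; lia.
have -> : s ^+ 2 * v 0 j = s * L (s ^+ p *: v) 0 j.
  by rewrite LZ Lv mxE mulrA.
apply: Ldeg => l.
have sp : s ^+ p = s ^+ (p - 2) * s ^+ 2 by rewrite -exprD subnK.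
rewrite mxE sp -mulrA.
exact: deg_leM (deg_leX _ ds) (dv l).
Qed.

(** Once N exceeds the number of monomials of bounded degree in m coordinates,
    the fixed points are dependent over k, hence over F_p. *)
Lemma semilinear_fixed_dependent : exists N, forall v : 'I_N -> 'rV[K]_m,
  (forall i, L (v i) = v i) -> (forall i j, exists e, deg_le e (v i 0 j)) ->
  exists2 z : 'I_N -> nat, exists i, (z i)%:R != 0 :> k & \sum_i v i *+ z i = 0.
Proof.
have [s [d [s0 bound]]] := fixed_points_bounded.
pose T : finType := ('I_m * 'X_{1..n < d.+1})%type.
exists #|T|.+1 => v Lv v_int.
have /choice[q qE] (ij : 'I_#|T|.+1 * 'I_m) : exists q : {mpoly k[n]},
    (msize q <= d.+1)%N /\ s ^+ 2 * v ij.1 0 ij.2 = mmap iota x q.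
  by have [q] := bound _ (Lv ij.1) (v_int ij.1) ij.2; exists q.
have [r r0 rE] := 
  homogeneous_system_solution (fun i (t : T) => (q (i, t.1))@_(bmnm t.2))
    (ltnSn _).
apply: (semilinear_descent pchark perfect LD LZ Lv r0).
apply/rowP => j; apply: (mulfI (expf_neq0 2 s0)).
rewrite summxE [in RHS]mxE mulr0 mulr_sumr.
transitivity (mmap iota x (\sum_i r i *: q (i, j))).
  rewrite raddf_sum /=; apply: eq_bigr => i _.
  by rewrite mxE mulrCA (qE (i, j)).2 mmapZ.
rewrite (_ : \sum_i _ = 0) ?mmap0 //; apply/mpolyP => mu.
rewrite mcoeff0 raddf_sum /=.
have [lt|le] := ltnP (mdeg mu) d.+1.
  rewrite -[RHS](rE (j, BMultinom lt)); apply: eq_bigr => i _.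
  by rewrite mcoeffZ.
apply: big1 => i _; rewrite mcoeffZ memN_msupp_eq0 ?mulr0 //.
apply: msize_mdeg_ge; exact: leq_trans (qE (i, j)).1 le.
Qed.
End SemilinearFixedPoints.

Section LogarithmicDerivatives.
Variables (k K : fieldType) (iota : {rmorphism k -> K}) (n : nat) (x : 'I_n -> K).
Variables (p : nat) (pchark : p \in [pchar k]).
Hypothesis perfect : forall c : k, exists d, c = d ^+ p.
Local Notation deg_le := (deg_le iota x).
Hypothesis frac : forall f, exists d a b,
  [/\ deg_le d a, deg_le d b, b != 0 & f = a / b].

Let pcharK : p \in [pchar K]. Proof. exact: (rmorph_pchar iota). Qed.

(** Scalars of the perfect field k are p-th powers, so a derivation kills them
    and no linearity over k has to be assumed. *)
Lemma derivation_eq0 (D : K -> K) :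
  {morph D : f g / f + g} -> (forall f g, D (f * g) = D f * g + f * D g) ->
  (forall j, D (x j) = 0) -> forall f, D f = 0.
Proof.
move=> DD DM Dx.
have Dmul f g : D f = 0 -> D g = 0 -> D (f * g) = 0.
  by move=> f0 g0; rewrite DM f0 g0 mul0r mulr0 addr0.
have D1 := derivation1 DM.
have Dint d u : deg_le d u -> D u = 0.
  move: u; apply: (deg_le_ind (P := fun u => D u = 0)) => [|u v Du Dv|c mu _].
  - exact: derivation0.
  - by rewrite DD Du Dv addr0.
  apply: (Dmul).
    by have [b ->] := perfect c; rewrite rmorphXn (derivationXp DM pcharK).
  apply: (big_ind (fun u => D u = 0)) => // j _.
  by elim: (mu j) => // i IHi; rewrite exprS; exact: Dmul.
move=> f; have [d [a [b [da db b0 fE]]]] := frac f.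
apply: (mulIf b0); transitivity (D (f * b)).
  by rewrite DM (Dint d b db) mulr0 addr0.
by rewrite mul0r fE mulfVK //; exact: (Dint d).
Qed.

Variable G : set (K -> K).
Hypotheses (GD : forall E, G E -> {morph E : f g / f + g})
  (GM : forall E, G E -> forall f g, E (f * g) = E f * g + f * E g)
  (Gp : forall E, G E -> G (iter p E)).

(** A member of G is determined by the row of its values at the generators, and
    finitely many such rows span all of them. *)
Lemma derivations_finite_span : exists m, exists2 E : 'I_m -> K -> K,
  forall i, G (E i) &
  forall D, G D -> exists c : 'rV[K]_m, forall f, D f = \sum_i c 0 i * E i f.
Proof.
have [m [W GW Wspan]] := finite_spanning_rows
  [set w | exists2 E, G E & w = \row_j E (x j)]%classic.
have /choice[E EG] i : exists E, G E /\ row i W = \row_j E (x j).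
  by have [E] := GW i; exists E.
exists m, E => [i|D GDD]; first exact: (EG i).1.
have /submxP[c cE] : (\row_j D (x j) <= W)%MS by apply: Wspan; exists D.
exists c => f; apply/eqP; rewrite -subr_eq0; apply/eqP.
apply: (derivation_eq0 (D := fun f => D f - \sum_i c 0 i * E i f)) => [g h|g h|j].
- rewrite (GD GDD) (eq_bigr (fun i => c 0 i * E i g + c 0 i * E i h)).
    by rewrite big_split /= opprD addrACA.
  by move=> i _; rewrite (GD (EG i).1) mulrDr.
- rewrite (GM GDD) (eq_bigr (fun i => c 0 i * E i g * h + g * (c 0 i * E i h))).
    rewrite big_split /= -mulr_suml -mulr_sumr mulrBl mulrBr opprD.
    by rewrite addrACA.
  by move=> i _; rewrite (GM (EG i).1) mulrDr mulrA (mulrCA g).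
have := congr1 (fun w : 'rV_n => w 0 j) cE; rewrite !mxE => ->.
apply/eqP; rewrite subr_eq0; apply/eqP; apply: eq_bigr => i _.
by have := congr1 (fun w : 'rV_n => w 0 j) (EG i).2; rewrite !mxE => ->.
Qed.

(** The vector of logarithmic derivatives of f along a spanning family E_1, ...,
    E_m of G is fixed by
      L v = (kappa (sum_j C_ij v_j - E_i^(p-1) v_i))_i,
    where E_i^p = sum_j C_ij E_j: by Hochschild's formula the argument of kappa
    is v_i^p. *)
Theorem log_derivatives_dependent : exists N, forall f : 'I_N -> K,
  (forall i, f i != 0) ->
  (forall i E, G E -> exists d, deg_le d (E (f i) / f i)) ->
  exists2 z : 'I_N -> nat, exists i, (z i)%:R != 0 :> k &
    forall E, G E -> \sum_i E (f i) / f i *+ z i = 0.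
Proof.
have [m [E GE Espan]] := derivations_finite_span.
have /choice[C CE] i := Espan _ (Gp (GE i)).
have [kappa kappaD [kappaZ kappa1]] :=
  frobenius_splitting pcharK (p_monomial_span pchark perfect frac).
pose L (v : 'rV[K]_m) : 'rV[K]_m :=
  \row_i kappa (\sum_j C i 0 j * v 0 j - iter p.-1 (E i) (v 0 i)).
have LD : {morph L : u v / u + v}.
  move=> u v; apply/rowP => i; rewrite !mxE -kappaD; congr (kappa _).
  rewrite (iter_derivationD (GD (GE i))) addrACA -opprD -big_split /=; congr (_ - _).
  by apply: eq_bigr => j _; rewrite mxE mulrDr.
have EZ i l b u : iter l (E i) (b ^+ p * u) = b ^+ p * iter l (E i) u.
  elim: l => // l IHl; rewrite !iterS IHl (GM (GE i)).
  by rewrite (derivationXp (GM (GE i)) pcharK) mul0r add0r.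
have LZ b v : L (b ^+ p *: v) = b *: L v.
  apply/rowP => i; rewrite !mxE -kappaZ; congr (kappa _).
  rewrite EZ mulrBr mulr_sumr; congr (_ - _); apply: eq_bigr => j _.
  by rewrite mxE mulrCA.
have [N dep] := semilinear_fixed_dependent pchark perfect frac LD LZ.
exists N => f f0 f_int.
pose v i : 'rV[K]_m := \row_j (E j (f i) / f i).
have Lv i : L (v i) = v i.
  apply/rowP => j; rewrite [RHS]mxE; set a := E j (f i) / f i.
  have Ef : E j (f i) = a * f i by rewrite mulfVK.
  rewrite mxE -[RHS]mulr1 -kappa1 -kappaZ mulr1; congr (kappa _).
  apply/eqP; rewrite subr_eq mxE; apply/eqP/(mulIf (f0 i)).
  rewrite -(hochschild_formula (GD (GE j)) (GM (GE j)) pcharK Ef) CE mulr_suml.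
  by apply: eq_bigr => l _; rewrite mxE mulrA mulfVK.
have [|z z0 zE] := dep v Lv.
  by move=> i j; rewrite mxE; exact: f_int.
exists z => // D /Espan[c cE].
transitivity (\sum_j c 0 j * (\sum_i v i *+ z i) 0 j).
  under [RHS]eq_bigr => j _ do rewrite summxE mulr_sumr.
  rewrite exchange_big /=; apply: eq_bigr => i _.
  rewrite cE mulr_suml -sumrMnl; apply: eq_bigr => j _.
  by rewrite mulmxnE mxE mulrnAr mulrA.
by rewrite zE big1 // => j _; rewrite mxE mulr0.
Qed.
End LogarithmicDerivatives.

(** * Algebraic solutions *)

Section AlgebraicSolutions.
Variables (p : nat) (k : fieldType) (pchark : p \in [pchar k]).
Variables (A : idomainAlgType k) (DD : set (derivation A)).

Let pcharK : p \in [pchar {fraction A}].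
Proof.
apply: (rmorph_pchar (@FracField.tofrac A)).
by apply: (rmorph_pchar (in_alg A)).
Qed.

(** Closed under E |-> E^p, so that Hochschild's formula stays in the family. *)
Definition frobenius_iterates : set ({fraction A} -> {fraction A}) :=
  [set E | exists2 D, DD D & exists j, E = iter (p ^ j) (derfrac D)]%classic.

Lemma frobenius_iteratesD E : frobenius_iterates E -> {morph E : f g / f + g}.
Proof. by move=> [D _ [j ->]]; exact: (@iter_derivationD _ (derfrac D) (derfracD D)). Qed.

Lemma frobenius_iterates_closed E :
  frobenius_iterates E -> frobenius_iterates (iter p E).
Proof.
move=> [D DD_D [j ->]]; exists D => //; exists j.+1; apply/funext => f.
by rewrite expnS iterM.
Qed.

Lemma frobenius_iteratesM E : frobenius_iterates E ->
  forall f g, E (f * g) = E f * g + f * E g.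
Proof.
move=> [D _ [j ->]]; elim: j => [|j IHj]; first exact: derfracM.
have iterE f : iter (p ^ j.+1) (derfrac D) f = iter p (iter (p ^ j) (derfrac D)) f.
  by rewrite expnS iterM.
move=> f g; rewrite !iterE; apply: pth_iter_derivationM => //.
exact: (@iter_derivationD _ (derfrac D) (derfracD D)).
Qed.

Lemma frobenius_iterates_solution f E : algebraic_solution DD f ->
  frobenius_iterates E -> exists a : A, E f / f = a%:F.
Proof.
move=> [f0 Df] [D DD_D [j ->]]; have [a aE] := Df D DD_D.
have {}aE : derfrac D f = a%:F * f by rewrite -aE (mulfVK f0).
have [b ->] : exists b : A, iter (p ^ j) (derfrac D) f = b%:F * f.
  elim: (p ^ j)%N => [|i [b bE]].
    by exists 1; rewrite tofrac1 mul1r.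
  exists (D b + b * a); rewrite iterS bE derfracM derfrac_tofrac aE.
  by rewrite tofracD tofracM mulrDl mulrA.
by exists b; exact: (mulfK f0).
Qed.

Lemma log_derivative_sum D I (s : seq I) (u : I -> algsol DD) (z : I -> nat) :
  let w : algsol DD := \sum_(i <- s) u i *+ z i in
  derfrac D (algsol_val w) / algsol_val w =
  \sum_(i <- s) derfrac D (algsol_val (u i)) / algsol_val (u i) *+ z i.
Proof.
pose l (v : algsol DD) := derfrac D (algsol_val v) / algsol_val v.
have l0 : l 0 = 0 by rewrite /l algsol_val0 derfrac1 mul0r.
have lD : {morph l : v w / v + w}.
  move=> v w; rewrite /l algsol_valD derfracM.
  exact: (logderM _ _ (algsol_neq0 v) (algsol_neq0 w)).
move=> w; transitivity (l w) => //; rewrite (big_morph l lD l0); apply: eq_bigr => i _.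
by elim: (z i) => [|m IHm]; rewrite ?mulr0n // !mulrS lD IHm.
Qed.

(** The class of a product vanishes when the product is a first integral, and
    logarithmic derivatives turn products into sums. *)
Lemma Pi_eq0 N (y : 'I_N -> Pi DD pchark) (z : 'I_N -> nat) :
  (forall D, DD D ->
     \sum_i derfrac D (algsol_val (repr (y i))) / algsol_val (repr (y i)) *+ z i
     = 0) ->
  \sum_i y i *+ z i = 0.
Proof.
move=> z_int; pose w : algsol DD := \sum_i repr (y i) *+ z i.
have w_int : w \in @firstint k A DD.
  apply/asboolP; split=> [|D DD_D]; first exact: algsol_neq0.
  have := log_derivative_sum D (index_enum 'I_N) (fun i => repr (y i)) z.
  rewrite /= z_int // => /eqP; rewrite mulf_eq0 invr_eq0.
  by rewrite (negbTE (algsol_neq0 _)) orbF => /eqP.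
pose pi_ := \pi_(Quotient.quot (@firstint k A DD))%qT : {additive _ -> _}.
transitivity (pi_ w).
  rewrite /w raddf_sum; apply: eq_bigr => i _.
  by rewrite raddfMn /= reprK.
by rewrite -[RHS](raddf0 pi_); apply/eqP; rewrite -Quotient.idealrBE subr0.
Qed.
End AlgebraicSolutions.

Lemma closed_field_pth_root p (k : closedFieldType) (c : k) :
  (0 < p)%N -> exists d, c = d ^+ p.
Proof.
case: p => // n _.
have [d dE] := @solve_monicpoly k n.+1 (nth 0 [:: c]) isT.
exists d; rewrite dE big_ord_recl mulr1 big1 ?addr0 // => i _.
by rewrite /= nth_nil mul0r.
Qed.

Theorem theorem1p3 (p : nat) (k : closedFieldType) (pchar_k : p \in [pchar k])
    (A : idomainAlgType k) (A_ft : finite_type A) (DD : set (derivation A)) :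
  finite_dimensional (Pi DD pchar_k).
Proof.
have [n [x xgen]] := A_ft.
have perfect (c : k) : exists d, c = d ^+ p.
  exact/closed_field_pth_root/prime_gt0/(pcharf_prime pchar_k).
pose iota : {rmorphism k -> {fraction A}} := (@FracField.tofrac A \o in_alg A)%FUN.
pose xF i := (x i)%:F.
have degF (a : A) : exists d, deg_le iota xF d a%:F.
  have [q ->] := xgen a; exists (msize q), q => //.
  rewrite /mmap rmorph_sum; apply: eq_bigr => mu _.
  rewrite rmorphM /= rmorph_prod; congr (_ * _).
  by apply: eq_bigr => i _; rewrite rmorphXn.
have frac f : exists d a b,
    [/\ deg_le iota xF d a, deg_le iota xF d b, b != 0 & f = a / b].
  have [a [b [b0 ->]]] := fracP f; have [[d da] [e eb]] := (degF a, degF b).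
  exists (maxn d e), a%:F, b%:F; split=> //.
    exact: deg_leW (leq_maxl _ _) da.
  exact: deg_leW (leq_maxr _ _) eb.
have [N dep] := log_derivatives_dependent pchar_k perfect frac
  (@frobenius_iteratesD p _ _ DD) (frobenius_iteratesM pchar_k (DD := DD))
  (@frobenius_iterates_closed p _ _ DD).
apply: (@finite_dimensional_of_dependent _ _ N) => y.
have [||z [i zi] z_int] := dep (fun i => algsol_val (repr (y i))).
- by move=> i; exact: algsol_neq0.
- move=> i E GE; have [a ->] := frobenius_iterates_solution (algsolP (repr (y i))) GE.
  exact: degF.
exists (fun i => (z i)%:R).
  exists i; rewrite -(dvdn_pcharf (pchar_Fp (pcharf_prime pchar_k))).
  by rewrite (dvdn_pcharf pchar_k).
under eq_bigr => j _ do rewrite scaler_nat.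
by apply: Pi_eq0 => D DD_D; apply: z_int; exists D => //; exists 0.
Qed.
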